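(* Let $F\subset\mathbb{R}^d$ be a compact convex set with $0\in\operatorname{int}(F)$, and let $m\ge2$, $1\le k\le m$. Let $\hat\Omega\in\mathcal{K}^m$ be arbitrary. If $S_k(\hat\Omega)$ is compact, then there exists a neighborhood $U$ of $\hat\Omega$ in $(\mathcal{K}^m,d_{\mathcal{K}^m})$ such that $S_k(\Omega)$ is compact for every $\Omega\in U$.
   Context: $\mathbb{R}^d$ ($d\ge1$) and $\mathbb{R}^{dk}=(\mathbb{R}^d)^k$ carry their Euclidean norms. The minimal time function is $T_F(x,\Omega)=\inf\{t\ge 0\mid (x+tF)\cap\Omega\neq\emptyset\}$ for $x\in\mathbb{R}^d$ and nonempty $\Omega\subset\mathbb{R}^d$. $\mathcal{K}$ is the family of nonempty compact subsets of $\mathbb{R}^d$ with the Hausdorff metric $d_{\mathcal{K}}(A,B)=\max\{\sup_{a\in A}\inf_{b\in B}\|a-b\|,\ \sup_{b\in B}\inf_{a\in A}\|a-b\|\}$; on $\mathcal{K}^m$, $d_{\mathcal{K}^m}(\Omega,\hat\Omega)=\max_{1\le i\le m}d_{\mathcal{K}}(\Omega^i,\hat\Omega^i)$ for $\Omega=(\Omega^1,\dots,\Omega^m)$, $\hat\Omega=(\hat\Omega^1,\dots,\hat\Omega^m)$. For $x=(x^1,\dots,x^k)\in\mathbb{R}^{dk}$, $f_k(x,\Omega)=\sum_{i=1}^m\min_{1\le j\le k}T_F(x^j,\Omega^i)$, $v_k(\Omega)=\min_{x\in\mathbb{R}^{dk}}f_k(x,\Omega)$, and $S_k(\Omega)=\{x\in\mathbb{R}^{dk}\mid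 f_k(x,\Omega)=v_k(\Omega)\}$. *)

(* Defs.v *)
From HB Require Import structures.
From mathcomp Require Import all_boot all_order all_algebra.
From mathcomp Require Import all_classical all_reals all_analysis.
Set Implicit Arguments.
Unset Strict Implicit.
Unset Printing Implicit Defensive.
Import Order.TTheory GRing.Theory Num.Theory.
Import numFieldNormedType.Exports.
Local Open Scope classical_set_scope.
Local Open Scope ring_scope.

(* R^d is 'rV[R]_d and R^(dk) = (R^d)^k is 'M[R]_(k, d), whose row j is x^j.
   The library norm on matrices is the sup norm. It induces the same topology
   as the Euclidean norm, so [compact] and [interior] are the library's, while
   the Hausdorff distance, a metric notion, uses [eucl_norm]. *)

Definition eucl_norm (R : realType) (d : nat) (u : 'rV[R]_d) : R :=
  Num.sqrt (\sum_(i < d) u 0 i ^+ 2).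

(* The real-valued [inf] is 0 on an empty set, but when 0 is interior to F and
   Omega is nonempty the set below is nonempty (and bounded below by 0). *)
Definition minimal_time (R : realType) (d : nat) (F : set 'rV[R]_d)
    (x : 'rV[R]_d) (Omega : set 'rV[R]_d) : R :=
  inf [set t : R | 0 <= t /\ [set x + t *: f | f in F] `&` Omega !=set0].

Record nonempty_compact (R : realType) (d : nat) := NonemptyCompact {
  nonempty_compact_set :> set 'rV[R]_d ;
  nonempty_compact_neq0 : nonempty_compact_set !=set0 ;
  nonempty_compact_compact : compact nonempty_compact_set }.

(* All the suprema and infima are finite since A and B are nonempty and
   bounded. *)
Definition hausdorff_dist (R : realType) (d : nat)
    (A B : nonempty_compact R d) : R :=
  Num.max
    (sup [set inf [set eucl_norm (a - b) | b in (B : set _)]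
         | a in (A : set _)])
    (sup [set inf [set eucl_norm (a - b) | a in (A : set _)]
         | b in (B : set _)]).

(* The neutral element 0 is harmless: Hausdorff distances are nonnegative. *)
Definition hausdorff_dist_tuple (R : realType) (d m : nat)
    (Omega Omega' : 'I_m -> nonempty_compact R d) : R :=
  \big[Num.max/0]_(i < m) hausdorff_dist (Omega i) (Omega' i).

Definition hausdorff_nbhs (R : realType) (d m : nat)
    (Omega : 'I_m -> nonempty_compact R d)
    (U : set ('I_m -> nonempty_compact R d)) : Prop :=
  exists2 e : R, 0 < e &
    [set Omega' | hausdorff_dist_tuple Omega Omega' < e] `<=` U.

(* For 0 < k the inner infimum, over the finite nonempty range of j, is the
   minimum over j. *)
Definition multi_time_cost (R : realType) (d m k : nat) (F : set 'rV[R]_d)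
    (Omega : 'I_m -> nonempty_compact R d) (x : 'M[R]_(k, d)) : R :=
  \sum_(i < m) inf (range (fun j : 'I_k => minimal_time F (row j x) (Omega i))).

(* Written as an infimum. It is the minimum whenever the minimum exists, and
   the solution set below is empty otherwise. *)
Definition optimal_value (R : realType) (d m k : nat) (F : set 'rV[R]_d)
    (Omega : 'I_m -> nonempty_compact R d) : R :=
  inf (range (@multi_time_cost R d m k F Omega)).

Definition solution_set (R : realType) (d m k : nat) (F : set 'rV[R]_d)
    (Omega : 'I_m -> nonempty_compact R d) : set 'M[R]_(k, d) :=
  [set x | multi_time_cost F Omega x = optimal_value k F Omega].

Arguments solution_set {R d m} k F Omega.

(* Main.v *)
(* Call a center far when it is too distant to serve any target within the
   optimal cost. If [S_k(Omega_hat)] is compact, the cost of [Omega_hat] stays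
   above its infimum by a fixed gap on a large sphere [`|x| = rho] of the sup
   norm. For [Omega] close to [Omega_hat], a solution of norm greater than
   [rho] has a far center; its far centers serve nothing and can be moved onto
   the sphere for free, and since the costs of [Omega] and [Omega_hat] are
   uniformly close this contradicts the gap. Hence [S_k(Omega)] is bounded,
   and it is closed by continuity; no minimizer has to exist. *)
Require Import Defs.
From mathcomp Require Import all_boot all_order all_algebra.
From mathcomp Require Import all_classical all_reals all_analysis.
From mathcomp Require Import ring lra.
Import Order.TTheory GRing.Theory Num.Theory.
Import numFieldNormedType.Exports.
Local Open Scope classical_set_scope.
Local Open Scope ring_scope.
Set Implicit Arguments.
Unset Strict Implicit.

(** * Sup norm on matrices, Lipschitz continuity, and compactness *)

Lemma mx_norm_le (R : realType) (m n : nat) (A : 'M[R]_(m, n)) (c : R) :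
  0 <= c -> (forall i j, `|A i j| <= c) -> `|A| <= c.
Proof.
move=> c0 Ac; rewrite [leLHS]/Num.Def.normr /= mx_normrE.
by apply/bigmax_leP; split => // -[i j] _ /=.
Qed.

Lemma entry_le_mx_norm (R : realType) (m n : nat) (A : 'M[R]_(m, n)) i j :
  `|A i j| <= `|A|.
Proof.
rewrite [leRHS]/Num.Def.normr /= mx_normrE.
by apply/bigmax_geP; right => /=; exists (i, j).
Qed.

Lemma row_le_mx_norm (R : realType) (m n : nat) (A : 'M[R]_(m, n)) i :
  `|row i A| <= `|A|.
Proof.
by apply: mx_norm_le => // i' j; rewrite mxE; exact: entry_le_mx_norm.
Qed.

Lemma dist_le_continuous (R : realType) (V W : normedModType R) (f : V -> W)
    (c : R) :
  (forall x y, `|f x - f y| <= c * `|x - y|) -> continuous f.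
Proof.
move=> fc x; apply/cvgrPdist_le => e e0.
have c0 : 0 < `|c| + 1 by rewrite ltr_wpDl.
have /cvgrPdist_le/(_ (e / (`|c| + 1))) := @cvg_id _ (nbhs x).
rewrite divr_gt0 // => /(_ isT); apply: filterS => y xy.
apply: le_trans (fc x y) _; rewrite ler_pdivlMr // in xy.
rewrite mulrC; apply: le_trans xy; rewrite ler_wpM2l //.
by apply: le_trans (ler_norm c) _; rewrite lerDl.
Qed.

(** Heine-Borel for row vectors, transported along [vec_mx], which preserves the sup norm. *)
Lemma mx_bounded_closed_compact (R : realType) (m n : nat)
    (A : set 'M[R]_(m, n)) (M : R) :
  (forall x, A x -> `|x| <= M) -> closed A -> compact A.
Proof.
move=> AM Acl.
have vec_cont : continuous (@vec_mx R m n).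
  apply: (dist_le_continuous (c := 1)) => v w; rewrite mul1r -linearB /=.
  by apply: mx_norm_le => // i j; rewrite mxE; exact: entry_le_mx_norm.
have -> : A = @vec_mx R m n @` (@vec_mx R m n @^-1` A).
  apply/seteqP; split => [x Ax|_ [v Av <-] //].
  by exists (mxvec x); rewrite /= mxvecK.
apply: continuous_compact; first exact: continuous_subspaceT.
apply: bounded_closed_compact.
  exists M; split; first exact: num_real.
  move=> N MN v Av; apply: le_trans (ltW MN); apply: le_trans (AM _ Av).
  apply: mx_norm_le => // i j; rewrite ord1.
  case/mxvec_indexP: j => a b; rewrite -{1}(vec_mxK v) mxvecE.
  exact: entry_le_mx_norm.
by apply: preimage_closed => // v _; exact: vec_cont.
Qed.

(** * Euclidean norm and Hausdorff distance *)

Lemma mx_norm_le_eucl_norm (R : realType) (d : nat) (u : 'rV[R]_d) :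
  `|u| <= eucl_norm u.
Proof.
apply: mx_norm_le; first exact: sqrtr_ge0.
move=> i j; rewrite ord1 -sqrtr_sqr ler_sqrt; last first.
  by apply: sumr_ge0 => l _; exact: sqr_ge0.
by rewrite (bigD1 j) //= lerDl; apply: sumr_ge0 => l _; exact: sqr_ge0.
Qed.

Lemma eucl_norm_le_mx_norm (R : realType) (d : nat) (u : 'rV[R]_d) :
  eucl_norm u <= Num.sqrt d%:R * `|u|.
Proof.
rewrite -[`|u|]normr_id -sqrtr_sqr -sqrtrM // ler_wsqrtr //.
have -> : d%:R * `|u| ^+ 2 = \sum_(i < d) `|u| ^+ 2.
  by rewrite sumr_const card_ord mulr_natl.
apply: ler_sum => i _.
by rewrite -[leLHS]real_normK ?num_real // lerXn2r ?nnegrE //;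
  exact: entry_le_mx_norm.
Qed.

Lemma eucl_normB (R : realType) (d : nat) (u v : 'rV[R]_d) :
  eucl_norm (u - v) = eucl_norm (v - u).
Proof.
by congr Num.sqrt; apply: eq_bigr => i _; rewrite -sqrrN !mxE opprB.
Qed.

Lemma hausdorff_distC (R : realType) (d : nat) (A B : nonempty_compact R d) :
  hausdorff_dist A B = hausdorff_dist B A.
Proof.
rewrite /hausdorff_dist maxC; congr (Num.max (sup _) (sup _));
  by apply: eq_imagel => a _; congr inf; apply: eq_imagel => b _;
     exact: eucl_normB.
Qed.

Lemma nonempty_compact_bounded (R : realType) (d : nat)
    (A : nonempty_compact R d) :
  exists M : R, forall a, (A : set _) a -> `|a| <= M.
Proof.
have [M [_ AM]] := compact_bounded (@nonempty_compact_compact _ _ A).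
by exists (M + 1) => a Aa; apply: (AM (M + 1)) => //; rewrite ltrDl.
Qed.

Lemma hausdorff_dist_near (R : realType) (d : nat)
    (A B : nonempty_compact R d) (e : R) (a : 'rV[R]_d) :
  hausdorff_dist A B < e -> (A : set _) a ->
  exists2 b, (B : set _) b & `|a - b| < e.
Proof.
rewrite gt_max => /andP[supe _] Aa.
set D := fun a : 'rV[R]_d => [set eucl_norm (a - b) | b in (B : set _)].
have [b0 Bb0] := nonempty_compact_neq0 B.
have D0 x : has_inf (D x).
  split; first by exists (eucl_norm (x - b0)); exists b0.
  by exists 0 => _ [b _ <-]; exact: sqrtr_ge0.
have : inf (D a) < e.
  apply: le_lt_trans supe; apply: ub_le_sup; last by exists a.
  (* A crude upper bound suffices: the supremum has to be a genuine one to dominate the distance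
     from [a] to [B]. *)
  have [M AM] := nonempty_compact_bounded A.
  exists (Num.sqrt d%:R * (M + `|b0|)) => _ [x Ax <-].
  apply: (@le_trans _ _ (eucl_norm (x - b0))).
    by apply: ge_inf; [exact: (D0 x).2|exists b0].
  apply: le_trans (eucl_norm_le_mx_norm _) _.
  rewrite ler_wpM2l ?sqrtr_ge0 //; apply: le_trans (ler_normB _ _) _.
  by rewrite lerD2r; exact: AM.
move=> /(inf_lt (D0 a).1)[_ [b Bb <-]] abe; exists b => //.
exact: le_lt_trans (mx_norm_le_eucl_norm _) abe.
Qed.

Lemma hausdorff_dist_tuple_lt (R : realType) (d m : nat)
    (Omega Omega' : 'I_m -> nonempty_compact R d) (e : R) i :
  hausdorff_dist_tuple Omega Omega' < e ->
  hausdorff_dist (Omega i) (Omega' i) < e.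
Proof.
apply: le_lt_trans.
exact: (le_bigmax (0 : R) (fun i => hausdorff_dist (Omega i) (Omega' i))).
Qed.

(** * The minimal time function *)

Lemma reach_times_neq0 (R : realType) (d : nat) (F : set 'rV[R]_d) (r : R)
    (x : 'rV[R]_d) (Omega : set 'rV[R]_d) :
  0 < r -> (forall u, `|u| <= r -> F u) -> Omega !=set0 ->
  [set t : R | 0 <= t /\ [set x + t *: f | f in F] `&` Omega !=set0] !=set0.
Proof.
move=> r0 Fr [w Omegaw]; pose t := `|w - x| / r + 1.
have t0 : 0 < t by rewrite ltr_wpDl // divr_ge0 // ltW.
exists t; split; first exact: ltW.
exists w; split => //; exists (t^-1 *: (w - x)).
  apply: Fr; rewrite normrZ ger0_norm ?invr_ge0 ?(ltW t0) //.
  by rewrite ler_pdivrMl // mulrDl divfK ?gt_eqF // mul1r lerDl ltW.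
by rewrite scalerA divff ?gt_eqF // scale1r addrC subrK.
Qed.

(* The hypothesis says that [x' + (t + s) F] meets [Omega'] whenever [x + t F]
   meets [Omega]: the correction of size at most [s * r] is [s] times a point
   of the ball contained in [F], and [t F + s F = (t + s) F] by convexity. *)
Lemma minimal_time_shift (R : realType) (d : nat) (F : set 'rV[R]_d) (r s : R)
    (x x' : 'rV[R]_d) (Omega Omega' : set 'rV[R]_d) :
  0 < r -> (forall u, `|u| <= r -> F u) -> convex_set F -> 0 <= s ->
  Omega !=set0 ->
  (forall w, Omega w ->
    exists2 w', Omega' w' & `|x - x' + (w' - w)| <= s * r) ->
  minimal_time F x' Omega' <= minimal_time F x Omega + s.
Proof.
move=> r0 Fr Fconv s0 Omega0 near; rewrite -lerBlDr.
apply: lb_le_inf; first exact: reach_times_neq0 r0 Fr Omega0.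
move=> t [t0 [_ [[f Ff <-] /near[w' w'Omega' ew]]]].
rewrite lerBlDr; apply: ge_inf; first by exists 0 => ? [].
split; first exact: addr_ge0.
set e := x - x' + _ in ew.
suff [g Fg ge] : exists2 g, F g & (t + s) *: g = t *: f + e.
  exists w'; split => //; exists g => //; rewrite ge /e.
  by apply/rowP => i; rewrite !mxE; ring.
move: s0; rewrite le_eqVlt => /predU1P[s0|s0].
  exists f => //; rewrite -s0 mul0r normr_le0 in ew.
  by rewrite (eqP ew) -s0 !addr0.
have ts0 : 0 < t + s by rewrite ltr_wpDl.
(* The point [g] is the convex combination of [f] and [s^-1 *: e] with weights [t / (t + s)] and
   [s / (t + s)]. *)
have p01 : 0 <= t / (t + s) <= 1.
  by rewrite divr_ge0 ?(ltW ts0) //= ler_pdivrMr // mul1r lerDl ltW.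
have Fe : F (s^-1 *: e).
  apply: Fr; rewrite normrZ ger0_norm ?invr_ge0 ?(ltW s0) //.
  by rewrite ler_pdivrMl // mulrC.
have := Fconv f (s^-1 *: e) (Itv01 (proj1 (andP p01)) (proj2 (andP p01))).
rewrite !inE => /(_ Ff Fe) Fg; eexists; first exact: Fg.
rewrite /conv /= scalerDr !scalerA /unstable.onem; congr (_ *: _ + _).
  by field; rewrite gt_eqF.
rewrite -[RHS]scale1r; congr (_ *: _); field.
by rewrite !gt_eqF.
Qed.

Lemma minimal_time_ge0 (R : realType) (d : nat) (F : set 'rV[R]_d)
    (x : 'rV[R]_d) (Omega : set 'rV[R]_d) :
  0 <= minimal_time F x Omega.
Proof.
rewrite /minimal_time; set D := mkset _.
(* With no reaching time, [inf] takes its default value 0. *)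
have [->|/set0P D0] := eqVneq D set0; first by rewrite inf0.
by apply: lb_le_inf => // t [].
Qed.

(** If [x + t f] lies in [Omega], then [x] differs from a point of norm at most [w] by a vector of
    norm at most [t * b]. Thus distant centers have large travel times. *)
Lemma minimal_time_coercive (R : realType) (d : nat) (F : set 'rV[R]_d)
    (r b w : R) (x : 'rV[R]_d) (Omega : set 'rV[R]_d) :
  0 < r -> (forall u, `|u| <= r -> F u) -> 0 < b ->
  (forall f, F f -> `|f| <= b) -> (forall a, Omega a -> `|a| <= w) ->
  Omega !=set0 ->
  `|x| <= w + b * minimal_time F x Omega.
Proof.
move=> r0 Fr b0 Fb Omegaw Omega0.
rewrite -lerBlDl mulrC -ler_pdivrMr //.
apply: lb_le_inf; first exact: reach_times_neq0 r0 Fr Omega0.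
move=> t [t0 [_ [[f Ff <-] /Omegaw xw]]]; rewrite ler_pdivrMr // lerBlDl.
rewrite -[x in `|x|](addrK (t *: f)); apply: le_trans (ler_normB _ _) _.
by rewrite lerD // normrZ ger0_norm // ler_wpM2l // Fb.
Qed.

(** * The cost and the optimal value *)

Lemma inf_range_ord (R : realType) (k : nat) (g : 'I_k -> R) :
  (0 < k)%N -> exists2 j, inf (range g) = g j & forall j', g j <= g j'.
Proof.
case: k g => // k g _.
case: (@Order.TotalTheory.arg_minP _ R _ ord0 predT g) => // j _ jmin.
exists j => [|j']; last exact: jmin.
apply/eqP; rewrite eq_le; apply/andP; split.
  by apply: ge_inf; [exists (g j) => _ [j' _ <-]; exact: jmin|exists j].
by apply: lb_le_inf; [exists (g j); exists j|move=> _ [j' _ <-]; exact: jmin].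
Qed.

Lemma multi_time_cost_ge0 (R : realType) (d m k : nat) (F : set 'rV[R]_d)
    (Omega : 'I_m -> nonempty_compact R d) (x : 'M[R]_(k, d)) :
  (0 < k)%N -> 0 <= multi_time_cost F Omega x.
Proof.
move=> k0; apply: sumr_ge0 => i _.
by have [j -> _] := inf_range_ord
  (fun j => minimal_time F (row j x) (Omega i)) k0; exact: minimal_time_ge0.
Qed.

Lemma optimal_value_le (R : realType) (d m k : nat) (F : set 'rV[R]_d)
    (Omega : 'I_m -> nonempty_compact R d) (x : 'M[R]_(k, d)) :
  (0 < k)%N -> optimal_value k F Omega <= multi_time_cost F Omega x.
Proof.
move=> k0; apply: ge_inf; last by exists x.
by exists 0 => _ [y _ <-]; exact: multi_time_cost_ge0.
Qed.

(** For each target, the best center of [x] also bounds the minimum at [x'], up to [s]. Both centers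
    and targets vary, so this yields continuity in [x] as well as stability in [Omega]. *)
Lemma multi_time_cost_shift (R : realType) (d m k : nat) (F : set 'rV[R]_d)
    (Omega Omega' : 'I_m -> nonempty_compact R d) (x x' : 'M[R]_(k, d))
    (s : R) :
  (0 < k)%N ->
  (forall i j, minimal_time F (row j x') (Omega' i) <=
               minimal_time F (row j x) (Omega i) + s) ->
  multi_time_cost F Omega' x' <= multi_time_cost F Omega x + m%:R * s.
Proof.
move=> k0 shift.
have -> : m%:R * s = \sum_(i < m) s by rewrite sumr_const card_ord mulr_natl.
rewrite -big_split; apply: ler_sum => i _ /=.
have [j -> _] := inf_range_ord
  (fun j => minimal_time F (row j x) (Omega i)) k0.
have [j' -> j'min] := inf_range_ord
  (fun j => minimal_time F (row j x') (Omega' i)) k0.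
exact: le_trans (j'min j) (shift i j).
Qed.

Lemma multi_time_cost_continuous (R : realType) (d m k : nat)
    (F : set 'rV[R]_d) (r : R) (Omega : 'I_m -> nonempty_compact R d) :
  (0 < k)%N -> 0 < r -> (forall u, `|u| <= r -> F u) -> convex_set F ->
  continuous (@multi_time_cost R d m k F Omega).
Proof.
move=> k0 r0 Fr Fconv.
(* Moving a center by at most [|x - x'|] changes each travel time by at most [|x - x'| / r], and
   there are [m] targets. *)
have lip (x x' : 'M[R]_(k, d)) : multi_time_cost F Omega x' <=
    multi_time_cost F Omega x + m%:R / r * `|x - x'|.
  rewrite -mulrA; apply: multi_time_cost_shift => // i j.
  apply: (minimal_time_shift r0 Fr Fconv).
  - by rewrite mulr_ge0 // invr_ge0 ltW.
  - exact: nonempty_compact_neq0.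
  - move=> w Omegaw; exists w => //.
    rewrite subrr addr0 -linearB mulrAC mulVf ?gt_eqF // mul1r.
    exact: row_le_mx_norm.
apply: (@dist_le_continuous _ _ R^o _ (m%:R / r)) => x y.
by rewrite ler_norml; have := lip x y; have := lip y x; rewrite distrC; lra.
Qed.

Lemma solution_set_closed (R : realType) (d m k : nat)
    (F : set 'rV[R]_d) (Omega : 'I_m -> nonempty_compact R d) :
  continuous (@multi_time_cost R d m k F Omega) ->
  closed (solution_set k F Omega).
Proof.
move=> cont; apply: (@preimage_closed _ _ _ [set optimal_value k F Omega]).
  by move=> x _; exact: cont.
exact: closed_eq.
Qed.

Lemma optimal_value_shift (R : realType) (d m k : nat) (F : set 'rV[R]_d)
    (Omega Omega' : 'I_m -> nonempty_compact R d) (s : R) :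
  (0 < k)%N ->
  (forall x : 'M[R]_(k, d),
    multi_time_cost F Omega' x <= multi_time_cost F Omega x + s) ->
  optimal_value k F Omega' <= optimal_value k F Omega + s.
Proof.
move=> k0 shift; rewrite -lerBlDr; apply: lb_le_inf.
  by exists (multi_time_cost F Omega (0 : 'M[R]_(k, d))); exists 0.
move=> _ [x _ <-]; rewrite lerBlDr.
exact: le_trans (optimal_value_le F Omega' x k0) (shift x).
Qed.

Lemma minimal_time_hausdorff (R : realType) (d : nat) (F : set 'rV[R]_d)
    (r s : R) (x : 'rV[R]_d) (A B : nonempty_compact R d) :
  0 < r -> (forall u, `|u| <= r -> F u) -> convex_set F -> 0 <= s ->
  hausdorff_dist A B < s * r ->
  minimal_time F x B <= minimal_time F x A + s.
Proof.
move=> r0 Fr Fconv s0 AB; apply: (minimal_time_shift r0 Fr Fconv s0).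
  exact: nonempty_compact_neq0.
move=> a /(hausdorff_dist_near AB)[b Bb ab]; exists b => //.
by rewrite subrr add0r distrC ltW.
Qed.

(** * The gap on a sphere and the relocation of far centers *)

Lemma sphere_gap (R : realType) (k d : nat) (f : 'M[R]_(k, d) -> R)
    (v rho : R) :
  continuous f -> (forall z, `|z| = rho -> v < f z) ->
  exists2 g, 0 < g & forall z, `|z| = rho -> v + g <= f z.
Proof.
move=> fcont vf; set S := [set z : 'M[R]_(k, d) | `|z| = rho].
(* The sphere can be empty, for instance when [rho < 0]; any gap then works. *)
have [S0|/set0P S0] := eqVneq S set0.
  by exists 1 => // z zrho; have : S z by []; rewrite S0.
have Scomp : compact S.
  apply: (@mx_bounded_closed_compact _ _ _ _ rho); first by move=> x ->.
  have -> : S = (fun z : 'M[R]_(k, d) => `|z|) @^-1` [set rho] by [].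
  apply: preimage_closed; last exact: closed_eq.
  by move=> z _; exact: norm_continuous.
have [c cS cmin] := compact_EVT_min S0 Scomp (continuous_subspaceT fcont).
exists (f c - v) => [|z zrho].
  by rewrite subr_gt0; apply: vf; move: cS; rewrite inE.
by rewrite addrC subrK; apply: cmin; rewrite inE.
Qed.

(* A center whose travel time to every target exceeds the whole cost serves no
   target, so all such centers may be moved at no cost. *)
Lemma multi_time_cost_clamp (R : realType) (d m k : nat) (F : set 'rV[R]_d)
    (Omega : 'I_m -> nonempty_compact R d) (x : 'M[R]_(k, d)) (rho : R) :
  (0 < d)%N -> (0 < k)%N -> 0 <= rho -> rho < `|x| ->
  (forall i j, rho < `|row j x| ->
     multi_time_cost F Omega x < minimal_time F (row j x) (Omega i)) ->
  exists2 x' : 'M[R]_(k, d), `|x'| = rho &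
    multi_time_cost F Omega x' <= multi_time_cost F Omega x.
Proof.
move=> d0 k0 rho0 rhox far.
(* Each far row becomes the constant row [rho], of sup norm [rho] because [0 < d]. *)
pose x' : 'M[R]_(k, d) :=
  \matrix_(j, l) if rho < `|row j x| then rho else x j l.
have [j0 j0far] : exists j, rho < `|row j x|.
  apply: contrapT => /forallNP near; move: rhox; rewrite ltNge => /negP; apply.
  apply: mx_norm_le => // j l; have /negP := near j; rewrite -leNgt.
  by apply: le_trans; have := entry_le_mx_norm (row j x) 0 l; rewrite mxE.
exists x'.
  apply/eqP; rewrite eq_le; apply/andP; split.
    apply: mx_norm_le => // j l; rewrite mxE; case: ltP => [_|].
      by rewrite ger0_norm.
    by apply: le_trans; have := entry_le_mx_norm (row j x) 0 l; rewrite mxE.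
  have := entry_le_mx_norm x' j0 (Ordinal d0).
  by rewrite mxE j0far ger0_norm.
apply: ler_sum => i _.
have [j' -> j'min] := inf_range_ord
  (fun j => minimal_time F (row j x') (Omega i)) k0.
have [j jE jmin] := inf_range_ord
  (fun j => minimal_time F (row j x) (Omega i)) k0.
(* The center serving target [i] is not far: its travel time is one summand of the cost, hence at
   most the cost. *)
rewrite jE; have jnear : `|row j x| <= rho.
  rewrite leNgt; apply/negP => /(far i); rewrite ltNge => /negP; apply.
  rewrite /multi_time_cost (bigD1 i) //= jE lerDl; apply: sumr_ge0 => i' _.
  by have [l -> _] := inf_range_ord
    (fun j => minimal_time F (row j x) (Omega i')) k0; exact: minimal_time_ge0.
apply: le_trans (j'min j) _; have -> // : row j x' = row j x.
by apply/rowP => l; rewrite !mxE ltNge jnear.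
Qed.

Unset Implicit Arguments.

Theorem proposition6p5 (R : realType) (d m k : nat) (F : set 'rV[R]_d)
    (hd : (1 <= d)%N) (hm : (2 <= m)%N) (hk : (1 <= k)%N) (hkm : (k <= m)%N)
    (F_compact : compact F) (F_convex : convex_set F)
    (F_int0 : interior F 0)
    (Omega_hat : 'I_m -> nonempty_compact R d) :
  compact (solution_set k F Omega_hat) ->
  exists U : set ('I_m -> nonempty_compact R d),
    hausdorff_nbhs Omega_hat U /\
    forall Omega : 'I_m -> nonempty_compact R d,
      U Omega -> compact (solution_set k F Omega).
Proof.
move=> S_compact.
have [r r0 Fr] : exists2 r, 0 < r & forall u, `|u| <= r -> F u.
  have /nbhs_ballP[e /= e0 Fe] : nbhs (0 : 'rV[R]_d) F by [].
  exists (e / 2) => [|u ue]; first by rewrite divr_gt0.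
  apply: Fe; rewrite -ball_normE /= sub0r normrN.
  by apply: le_lt_trans ue _; rewrite ltr_pdivrMr // ltr_pMr // ltr1n.
have fcont Omega : continuous (@multi_time_cost R d m k F Omega).
  exact: multi_time_cost_continuous hk r0 Fr F_convex.
have [b b0 Fb] := ex_strict_bound_gt0 (compact_bounded F_compact).
have [w w_bound] : exists w, forall i a, (Omega_hat i : set _) a -> `|a| <= w.
  have /choice[w w_bound] i := nonempty_compact_bounded (Omega_hat i).
  exists (\big[Num.max/0]_i w i) => i a /w_bound/le_trans; apply.
  exact: le_bigmax.
have [q q0 Sq] := ex_strict_bound_gt0 (compact_bounded S_compact).
pose f0 := multi_time_cost F Omega_hat (0 : 'M[R]_(k, d)).
have f0_ge0 : 0 <= f0 by exact: multi_time_cost_ge0.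
(* The bound [q] keeps the sphere off the solution set. The other bound gives a center beyond [rho]
   a time above [f0 + 3] to every target of [Omega_hat], so above [f0 + 2] for a nearby [Omega],
   whose optimal value is at most [f0 + 1]. *)
pose rho := Num.max q (w + b * (f0 + 3)).
have rho0 : 0 <= rho by rewrite le_max ltW.
have [g g0 gap] : exists2 g, 0 < g & forall z : 'M[R]_(k, d), `|z| = rho ->
    optimal_value k F Omega_hat + g <= multi_time_cost F Omega_hat z.
  apply: sphere_gap => // z zrho; rewrite lt_neqAle optimal_value_le // andbT.
  apply/eqP => /esym/Sq /=; rewrite zrho ltNge => /negP; apply.
  by rewrite le_max lexx.
have m0 : 0 < m%:R :> R by rewrite ltr0n (leq_trans _ hm).
(* Costs and optimal values will each move by at most [delta], and two such errors must stay below
   [g]. *)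
pose delta := Num.min 1 (g / 3).
have delta0 : 0 < delta by rewrite lt_min ltr01 divr_gt0.
have [delta1 deltag] : delta <= 1 /\ delta <= g / 3.
  by apply/andP; rewrite -le_min.
(* The time error allowed per target; a Hausdorff distance below [s * r] guarantees it. *)
pose s := delta / m%:R.
have s0 : 0 < s by exact: divr_gt0.
have msE : m%:R * s = delta by rewrite mulrC divfK // gt_eqF.
have s1 : s <= 1.
  by rewrite ler_pdivrMr // mul1r (le_trans delta1) // ler1n (leq_trans _ hm).
exists [set Omega | hausdorff_dist_tuple Omega_hat Omega < s * r]; split.
  by exists (s * r) => //; exact: mulr_gt0.
move=> Omega near.
have shift i x : minimal_time F x (Omega i) <=
    minimal_time F x (Omega_hat i) + s.
  apply: minimal_time_hausdorff r0 Fr F_convex (ltW s0) _.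
  exact: hausdorff_dist_tuple_lt.
have shift_hat i x : minimal_time F x (Omega_hat i) <=
    minimal_time F x (Omega i) + s.
  apply: minimal_time_hausdorff r0 Fr F_convex (ltW s0) _.
  by rewrite hausdorff_distC; exact: hausdorff_dist_tuple_lt.
have cost (x : 'M[R]_(k, d)) : multi_time_cost F Omega x <=
    multi_time_cost F Omega_hat x + delta.
  by rewrite -msE; apply: multi_time_cost_shift.
have cost_hat (x : 'M[R]_(k, d)) : multi_time_cost F Omega_hat x <=
    multi_time_cost F Omega x + delta.
  by rewrite -msE; apply: multi_time_cost_shift.
apply: (@mx_bounded_closed_compact _ _ _ _ rho); last first.
  exact: solution_set_closed.
move=> x xS; rewrite leNgt; apply/negP => x_far.
have [|x' x'rho x'x] := multi_time_cost_clamp hd hk rho0 x_far (F := F)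
    (Omega := Omega).
- move=> i j jfar.
  have fx : multi_time_cost F Omega x <= f0 + 1.
    rewrite xS; apply: le_trans (optimal_value_le F Omega 0 hk) _.
    by apply: le_trans (cost 0) _; rewrite lerD2l.
  have : w + b * (f0 + 3) <
      w + b * minimal_time F (row j x) (Omega_hat i).
    apply: le_lt_trans (_ : rho < _); first by rewrite le_max lexx orbT.
    apply: lt_le_trans jfar _; apply: minimal_time_coercive r0 Fr b0 _ _ _.
    + by move=> f /Fb /ltW.
    + exact: w_bound.
    + exact: nonempty_compact_neq0.
  rewrite ltrD2l ltr_pM2l //.
  by have := shift_hat i (row j x); lra.
(* With [v] and [v_hat] the optimal values: [v_hat + g] is at most the [Omega_hat]-cost of [x'],
   hence at most [v + delta], hence at most [v_hat + 2 * delta], which is below [v_hat + g]. *)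
- have := optimal_value_shift hk cost.
  have := gap x' x'rho; have := cost_hat x'.
  by rewrite xS in x'x; lra.
Qed.
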